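(* Let $p$ be a prime, let $G$ be a finite $p$-group, and let $n$ be a non-negative integer such that $|G'| > p^{n(n-1)/2}$. Then there do not exist $p$ proper subgroups $H_1, \dots, H_p$ of $G$, at least one of which has index at least $p^2$ in $G$, such that every element $x \in G$ with $b(x) \geq n$ lies in $H_1 \cup \dots \cup H_p$.
   Context: $G'$ denotes the derived subgroup of $G$. For $x$ in a finite $p$-group $G$, the breadth $b(x)$ is defined by $|G : C_G(x)| = p^{b(x)}$, where $C_G(x)$ is the centralizer of $x$ in $G$. *)

(* Defs.v *)
From mathcomp Require Import all_boot all_fingroup all_solvable.
Set Implicit Arguments. Unset Strict Implicit. Unset Printing Implicit Defensive.
Local Open Scope group_scope.

Definition breadth (p : nat) (gT : finGroupType) (G : {set gT}) (x : gT) : nat :=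
  logn p #|G : 'C_G[x]|.

(* Main.v *)
(* Let [M] be a maximal subgroup of [G] and [Z <= M] the preimage of
   ['C_(M / M')(G / M')]. As [M / M'] is abelian,
   [#|M : Z| = #|G'| / #|M'| = p ^ k], and this is at most the class size of any [x] outside [M], while every [m] in
   [M] outside [Z] has smaller breadth in [M] than in [G]. Suppose the elements of
   [G] outside [p - 1] subgroups [A_i] and one subgroup [B] of index at least
   [p ^ 2] have breadth less than [n]; we bound [#|G'|] by [p ^ 'C(n, 2)] by
   induction on [#|G|]. Taking [M] in the pencil spanned by [A_1] and a maximal
   subgroup containing [B] makes [B] redundant inside [M], so [Z] can take its
   place: if [k = 0] then [G' = M'] and one passes to [M] with the same [n]; if
   [k >= 2] one passes to [M] and [n - 1]. If [k = 1], repeating the construction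
   inside [M], with [Z] as [B], gives a maximal subgroup [P] of [M] whose bound
   compensates the loss. *)
Require Import Defs.
From mathcomp Require Import all_boot all_fingroup all_solvable.
From mathcomp Require Import zify.
Local Open Scope group_scope.
Set Implicit Arguments.
Unset Strict Implicit.
Unset Printing Implicit Defensive.

(** * A union bound, and derived subgroups over an abelian normal subgroup *)

Lemma exists_notin_sets (T : finType) (D : {set T}) (s : seq {set T}) :
  (\sum_(S <- s) #|S| < #|D|)%N ->
  exists2 x, x \in D & {in s, forall S : {set T}, x \notin S}.
Proof.
elim: s D => [|S s IHs] D.
  by rewrite big_nil card_gt0 => /set0Pn[x Dx]; exists x.
rewrite big_cons -ltn_subRL => ltD.
have [|x /setDP[Dx S'x] s'x] := IHs (D :\: S).
  apply: leq_trans ltD _; rewrite leq_subLR -(cardsID S D) leq_add2r.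
  exact: subset_leq_card (subsetIr _ _).
by exists x => // R /predU1P[-> | /s'x].
Qed.

(* When [A] is abelian, [a |-> [~ a, y]] is a morphism on [A]; its image is
   all of [Q^`(1)] because [y] together with [A] generates [Q]. *)
Lemma card_der1_abelian_normal (gT : finGroupType) (Q A : {group gT}) y :
  abelian A -> A <| Q -> A <*> <[y]> = Q -> #|Q^`(1)| = #|A : 'C_A[y]|.
Proof.
move=> abA nAQ defQ; have [sAQ nA] := andP nAQ.
have Qy : y \in Q by rewrite -defQ mem_gen // inE cycle_id orbT.
have nAy : y \in 'N(A) by apply: subsetP Qy.
have fA a : a \in A -> [~ a, y] \in A.
  by move=> Aa; rewrite groupM ?groupV // memJ_norm.
have fM : {in A &, {morph (fun a => [~ a, y]) : a b / a * b}}.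
  move=> a b Aa Ab /=.
  by rewrite commMgJ conjgE ((centsP abA) _ (fA a Aa) _ Ab) mulKg.
pose f := Morphism fM; pose I := f @* A.
have sIA : I \subset A by apply/subsetP=> _ /morphimP[a _ Aa ->]; apply: fA.
have nIQ : Q \subset 'N(I).
  rewrite -defQ join_subG cycle_subG.
  rewrite (subset_trans (sub_abelian_cent abA sIA)) ?cent_sub //=.
  apply/normP/eqP; rewrite eqEcard cardJg leqnn andbT.
  apply/subsetP=> _ /imsetP[_ /morphimP[a _ Aa ->] ->].
  have Aay : a ^ y \in A by rewrite memJ_norm.
  rewrite /= conjRg (_ : y ^ y = y) ?conjgE ?mulKg //.
  by apply/morphimP; exists (a ^ y).
have -> : Q^`(1) = I.
  apply/eqP; rewrite eqEsubset; apply/andP; split; last first.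
    apply/subsetP=> _ /morphimP[a _ Aa ->].
    by rewrite mem_commg // (subsetP sAQ).
  apply: der1_min => //.
  have nIA : A \subset 'N(I) := subset_trans sAQ nIQ.
  have nIy : y \in 'N(I) := subsetP nIQ y Qy.
  (* Modulo [I], [y] commutes with [A], so the quotient of [Q] is abelian. *)
  have cAy : A / I \subset 'C(<[y]> / I).
    rewrite quotient_cycle // cent_cycle.
    apply/subsetP=> _ /morphimP[a Na Aa ->]; apply/cent1P/commgP.
    by rewrite -morphR //= coset_id //; apply: (mem_morphim f Aa Aa).
  rewrite -defQ quotientY ?cycle_subG //.
  by rewrite abelianY centsC cAy !quotient_abelian // cycle_abelian.
rewrite card_morphim setIid; congr #|A : _|.
apply/setP=> a; rewrite !in_setI; apply: andb_id2l => Aa.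
by rewrite 2!inE; apply/commgP/cent1P.
Qed.

(** * Breadth and maximal subgroups *)

Lemma leq_index_cent1 (gT : finGroupType) (M G : {group gT}) x :
  M \subset G -> (#|M : 'C_M[x]| <= #|G : 'C_G[x]|)%N.
Proof. by move=> sMG; rewrite !index_cent1 subset_leq_card // classS. Qed.

Lemma p_breadth p (gT : finGroupType) (G : {group gT}) x :
  prime p -> p.-group G -> #|G : 'C_G[x]| = (p ^ breadth p G x)%N.
Proof.
move=> pr_p pG; rewrite /breadth.
have /p_natP[k ->] : p.-nat #|G : 'C_G[x]|.
  exact: pnat_dvd (dvdn_indexg _ _) pG.
by rewrite pfactorK.
Qed.

(** Modulo the derived subgroup of [M], each [x] in [G] outside [M] generates [G] together with the
    abelian image of [M], so the index of its centralizer in that image does not depend on [x]. [Z]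
    is the preimage of one such centralizer. *)
Lemma maximal_breadth_step p (gT : finGroupType) (G M : {group gT}) :
  prime p -> p.-group G -> maximal M G ->
  exists k (Z : {group gT}),
    [/\ Z \subset M, #|M : Z| = (p ^ k)%N,
        #|G^`(1)| = (p ^ k * #|M^`(1)|)%N,
        forall x, x \in G -> x \notin M -> (k <= breadth p G x)%N
      & forall x, x \in M -> x \notin Z ->
          (breadth p M x < breadth p G x)%N].
Proof.
move=> pr_p pG maxM; have nMG := p_maximal_normal pG maxM.
have [sMG nM] := andP nMG; have pM := pgroupS sMG pG.
have N_G : M^`(1) <| G by apply: gFnormal_trans.
have [sNG nNG] := andP N_G; have nNM := subset_trans sMG nNG.
have gen x : x \in G -> x \notin M -> M <*> <[x]> = G.
  move=> Gx M'x; rewrite norm_joinEr ?cycle_subG ?(subsetP nM) //.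
  by apply: (mulg_normal_maximal nMG); rewrite ?cycle_subG.
have cardQ x : x \in G -> x \notin M ->
    #|(G / M^`(1))^`(1)| = #|M / M^`(1) : 'C_(M / M^`(1))[coset M^`(1) x]|.
  move=> Gx M'x; apply: card_der1_abelian_normal.
  - exact: sub_der1_abelian.
  - exact: quotient_normal.
  by rewrite -quotient_cycle ?(subsetP nNG) // -quotientY ?cycle_subG
    ?(subsetP nNG) // gen.
have sNM : M^`(1) \subset M := der_sub 1 M.
have cardG : #|G^`(1)| = (#|(G / M^`(1))^`(1)| * #|M^`(1)|)%N.
  rewrite -quotient_der // card_quotient; last first.
    exact: subset_trans (der_sub 1 G) nNG.
  by rewrite mulnC Lagrange // dergS.
have [x Gx M'x] := subsetPn (proper_subn (maxgroupp maxM)).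
pose Z := (coset M^`(1) @*^-1 'C_(M / M^`(1))[coset M^`(1) x])%G.
have sZM : Z \subset M.
  apply: (@subset_trans _ _ (coset M^`(1) @*^-1 (M / M^`(1)))).
    by rewrite cosetpreSK subsetIl.
  by rewrite quotientGK // der_normal.
have iZ : #|M : Z| = #|(G / M^`(1))^`(1)|.
  rewrite (cardQ x) // -(index_quotient_eq _ sZM nNM) /= ?cosetpreK //.
  by rewrite (subset_trans (subsetIr _ _)) // sub_cosetpre.
have /p_natP[k def_k] : p.-nat #|M : Z|.
  exact: pnat_dvd (dvdn_indexg _ _) pM.
exists k, Z; split=> //.
- by rewrite cardG -iZ def_k.
(* The [M]-class of [z] maps onto the class of its image under the image of [M], which has size
   [p ^ k]. *)
- move=> z Gz M'z; rewrite -(@leq_exp2l p) ?prime_gt1 // -p_breadth //.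
  rewrite -def_k iZ (cardQ z) //.
  apply: leq_trans (leq_index_cent1 z sMG).
  rewrite !index_cent1 -quotient_class ?(subsetP nNG) //.
  exact: leq_morphim.
move=> m Mm Z'm; rewrite -(@ltn_exp2l p) ?prime_gt1 // -!p_breadth //.
rewrite !index_cent1; apply: proper_card; rewrite properE classS //=.
(* If [m ^ x = m ^ h] with [h] in [M], then [[~ m, x] = [~ m, h]] dies in the quotient, so [m] lies
   in [Z]. *)
apply: contra Z'm => /subsetP/(_ (m ^ x)).
case/(_ (memJ_class m Gx))/imsetP => h Mh eq_mx.
have Nm := subsetP nNM m Mm; have Nx := subsetP nNG x Gx.
rewrite mem_morphpre // inE mem_quotient //=.
apply/cent1P/commgP; rewrite -morphR //= coset_id //.
by rewrite commgEl eq_mx -commgEl mem_commg.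
Qed.

(** * Elements outside few subgroups, and pencils of maximal subgroups *)

Lemma leq_sum_card (T : finType) (s : seq {set T}) c :
  {in s, forall S : {set T}, (#|S| <= c)%N} ->
  (\sum_(S <- s) #|S| <= size s * c)%N.
Proof.
elim: s => [|S s IHs] le_c; first by rewrite big_nil.
rewrite big_cons mulSn leq_add ?le_c ?mem_head //.
by apply: IHs => R sR; rewrite le_c // inE sR orbT.
Qed.

Lemma p_leq_card_setI p (gT : finGroupType) (G H : {group gT}) :
  prime p -> p.-group G -> ~~ (G \subset H) -> (#|G :&: H| * p <= #|G|)%N.
Proof.
move=> pr_p pG ntGH; rewrite -(LagrangeI G H) leq_mul2l; apply/orP; right.
have /p_natP[[|k] def_k] : p.-nat #|G : H|.
- exact: pnat_dvd (dvdn_indexg _ _) pG.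
- by case/negP: ntGH; rewrite -indexg_eq1 def_k.
by rewrite def_k expnS leq_pmulr // expn_gt0 prime_gt0.
Qed.

(* Every [H] meets [G] in at most [#|G| / p] elements, and [1] lies in all
   of them. *)
Lemma p_group_not_covered p (gT : finGroupType) (G : {group gT})
    (s : seq {group gT}) :
  prime p -> p.-group G -> (size s <= p)%N ->
  {in s, forall H : {group gT}, ~~ (G \subset H)} ->
  exists2 x, x \in G & {in s, forall H : {group gT}, x \notin H}.
Proof.
move=> pr_p pG les ntGs.
have [-> | ] := eqVneq s [::]; first by exists 1.
case: s => [//|H0 s0] in les ntGs * => _; set s := H0 :: s0 in les ntGs *.
have p_gt1 := prime_gt1 pr_p.
have [|_ /dvdnP[q def_q] _] := pgroup_pdiv pG.
  by apply: contraNneq (ntGs _ (mem_head _ _)) => ->; apply: sub1G.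
have q_gt0 : (0 < q)%N by have := cardG_gt0 G; rewrite def_q muln_gt0 => /andP[].
have leqH H : H \in s -> (#|(G :&: H) :\ 1%g| <= q.-1)%N.
  move=> sH; have := cardsD1 1%g (G :&: H); rewrite group1 add1n => eqH.
  have := p_leq_card_setI pr_p pG (ntGs _ sH).
  by rewrite eqH def_q leq_pmul2r ?prime_gt0 //; case: (q).
pose t := [seq (G :&: gval H) :\ 1 | H <- s].
have [|x Gx nx] := @exists_notin_sets _ G ([set 1] :: t).
  rewrite big_cons cards1 add1n.
  apply: leq_ltn_trans (_ : (p * q.-1).+1 < _)%N.
    rewrite ltnS (leq_trans (leq_sum_card (c := q.-1) _)) //.
      by move=> _ /mapP[H sH ->]; apply: leqH.
    by rewrite size_map leq_mul2r les orbT.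
  by rewrite def_q; nia.
have nx1 : x != 1 by have := nx _ (mem_head _ _); rewrite inE.
exists x => // H sH.
have tH : (G :&: H) :\ 1 \in t by apply/mapP; exists H.
by have := nx _ (@mem_behead _ ([set 1] :: t) _ tH); rewrite !inE nx1 Gx.
Qed.

Lemma p_index_not_sub_maximal (p : nat) (gT : finGroupType) (G A M : {group gT}) :
  p.-group G -> maximal A G -> M \subset G -> ~~ (M \subset A) ->
  #|M : A| = p.
Proof.
move=> pG maxA sMG ntMA.
rewrite -indexMg (mulg_normal_maximal (p_maximal_normal pG maxA)) //.
exact: p_maximal_index maxA.
Qed.

Lemma maximal_sub_eq (gT : finGroupType) (G A K : {group gT}) :
  maximal A G -> maximal K G -> K \subset A -> K :=: A.
Proof.
move=> /maxgroupP[prA _] /maxgroupP[_ maxK] sKA.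
by rewrite (maxK _ prA sKA).
Qed.

(** [D = K :&: A] has index [p ^ 2] in [G] and contains [x ^+ p], so [D] and [x] generate a subgroup
    [M] of index [p]. As [D] is maximal in [M] and [x] is not in [K], [M :&: K] is [D]. *)
Lemma p_maximal_pencil p (gT : finGroupType) (G K A : {group gT}) x :
  prime p -> p.-group G -> maximal K G -> maximal A G -> ~~ (K \subset A) ->
  x \in G -> x \notin K ->
  exists2 M : {group gT}, maximal M G & (x \in M) && (M :&: K \subset A).
Proof.
move=> pr_p pG maxK maxA ntKA Gx K'x.
have nKG := p_maximal_normal pG maxK; have nAG := p_maximal_normal pG maxA.
pose D := (K :&: A)%G; have nDG : D <| G by apply: normalI.
have [sDG nD] := andP nDG; have Nx := subsetP nD x Gx.
have xpD : x ^+ p \in D.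
  have xpN (N : {group gT}) : maximal N G -> x ^+ p \in N.
    move=> maxN; have nNG := p_maximal_normal pG maxN.
    have NNx := subsetP (normal_norm nNG) x Gx.
    rewrite -(p_maximal_index pG maxN) -card_quotient ?normal_norm //.
    by apply: coset_idr; rewrite ?groupX // morphX // expg_cardG // mem_quotient.
  by rewrite inE !xpN.
pose M := (D <*> <[x]>)%G.
have sMG : M \subset G by rewrite join_subG sDG cycle_subG.
have Mx : x \in M by rewrite mem_gen // inE cycle_id orbT.
have sDM : D \subset M := joing_subl _ _.
have iMD : #|M : D| = p.
  have nDM : M \subset 'N(D) := subset_trans sMG nD.
  rewrite -card_quotient //= quotientYidl ?cycle_subG // quotient_cycle //.
  apply: (nt_prime_order pr_p); first by rewrite -morphX //= coset_id.
  by apply: contraNneq K'x => /(coset_idr Nx)/setIP[].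
have iGD : #|G : D| = (p * p)%N.
  rewrite -(Lagrange_index (normal_sub nKG) (subsetIl K A)) indexgI.
  rewrite (p_maximal_index pG maxK); congr (_ * _)%N.
  exact: p_index_not_sub_maximal pG maxA (normal_sub nKG) ntKA.
have maxM : maximal M G.
  apply: p_index_maximal => //; have := Lagrange_index sMG sDM.
  rewrite iGD iMD => /eqP; rewrite eqn_pmul2r ?prime_gt0 //.
  by move=> /eqP->.
exists M; rewrite // Mx /=.
have maxD : maximal D M by apply: p_index_maximal; rewrite ?iMD.
have prMK : (M :&: K)%G \proper M.
  by rewrite properE subsetIl; apply: contra K'x => /subsetP/(_ x Mx)/setIP[].
have [_ maxD'] := maxgroupP maxD.
rewrite (maxD' (M :&: K)%G) ?subsetIr //.
by rewrite subsetI sDM subsetIl.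
Qed.

(* The overlap [#|M :&: A| = #|G| / p ^ 2] makes room for [B]. *)
Lemma p_group_avoid p (gT : finGroupType) (G A M B : {group gT})
    (s : seq {group gT}) :
  prime p -> p.-group G -> maximal A G -> maximal M G -> ~~ (M \subset A) ->
  (p ^ 2 <= #|G : B|)%N -> ((size s).+2 <= p)%N ->
  {in s, forall H : {group gT}, ~~ (G \subset H)} ->
  exists x, [/\ x \in G, x \notin M, x \notin B
              & {in A :: s, forall H : {group gT}, x \notin H}].
Proof.
move=> pr_p pG maxA maxM ntMA iB les ntGs.
have p_gt0 := prime_gt0 pr_p.
have [nMG nAG] := (p_maximal_normal pG maxM, p_maximal_normal pG maxA).
have [sMG sAG] := (normal_sub nMG, normal_sub nAG).
have cM := Lagrange sMG; rewrite (p_maximal_index pG maxM) in cM.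
have cA := Lagrange sAG; rewrite (p_maximal_index pG maxA) in cA.
have cMA := LagrangeI M A.
rewrite (p_index_not_sub_maximal pG maxA sMG ntMA) in cMA.
have cB := LagrangeI G B.
have cB1 : #|G :&: B| = #|(G :&: B)^#|.+1 by rewrite (cardsD1 1) group1.
have cMD := cardsID A M.
pose t := [seq G :&: gval H | H <- s].
have les_t : (\sum_(S <- t) #|S| <= size s * #|A|)%N.
  rewrite -(size_map (fun H : {group gT} => G :&: H)).
  apply: leq_sum_card => _ /mapP[H sH ->].
  by rewrite -(leq_pmul2r p_gt0) cA p_leq_card_setI // ntGs.
(* [M :\: A] has [#|A| - #|M :&: A|] elements and [G :&: B] at most [#|M :&: A|]. The identity is
   already in [A]; dropping it from [B] makes the inequality strict. *)
have [|x Gx nx] :=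
    @exists_notin_sets _ G [:: M :\: A, (G :&: B)^#, gval A & t].
  have le_BMA : (#|G :&: B| <= #|M :&: A|)%N.
    rewrite -(@leq_pmul2r (p ^ 2)) ?expn_gt0 ?p_gt0 //.
    rewrite -[in leqRHS]mulnn [leqRHS]mulnA cMA cM.
    by rewrite -cB leq_mul2l iB orbT.
  have cAM : #|M| = #|A| by apply/eqP; rewrite -(eqn_pmul2r p_gt0) cM cA.
  have lesA : ((size s).+1 * #|A| + #|A| <= #|G|)%N.
    by rewrite -cA mulnC -mulnSr leq_mul2l les orbT.
  rewrite mulSn in lesA; rewrite !big_cons.
  by move: cMD cB1 le_BMA les_t lesA cAM; lia.
have A'x : x \notin A by apply: nx; rewrite !inE eqxx !orbT.
have := nx (M :\: A); rewrite !inE eqxx A'x => /(_ isT) M'x.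
have := nx ((G :&: B)^#); rewrite !inE eqxx orbT Gx => /(_ isT).
have -> /= : x != 1 by apply: contraNneq A'x => ->.
move=> B'x; exists x; split=> // H /predU1P[-> // | sH].
have tH : G :&: H \in t by apply/mapP; exists H.
by have := nx (G :&: H); rewrite !(inE, tH) ?orbT Gx => ->.
Qed.

(** * The induction bounding the derived subgroup *)

Lemma maximal_setI_exists (gT : finGroupType) (G H : {group gT}) :
  ~~ (G \subset H) -> exists2 A : {group gT}, maximal A G & G :&: H \subset A.
Proof.
move=> ntGH; have [eqG|//] := maximal_exists (subsetIl G H).
by case/negP: ntGH; rewrite -eqG subsetIr.
Qed.

Lemma maximal_not_sub (gT : finGroupType) (G A : {group gT}) :
  maximal A G -> ~~ (G \subset A).
Proof. by move/maxgroupp/proper_subn. Qed.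

Lemma leq_breadth p (gT : finGroupType) (M G : {group gT}) x :
  prime p -> p.-group G -> M \subset G ->
  (breadth p M x <= breadth p G x)%N.
Proof.
move=> pr_p pG sMG; rewrite -(@leq_exp2l p) ?prime_gt1 //.
by rewrite -!p_breadth ?leq_index_cent1 // (pgroupS sMG).
Qed.

(** The subgroups need only fail to contain [G], so the same [s] survives the passage to a subgroup;
    the induction varies only [G], [n], [a] and [B]. *)
Lemma card_der1_breadth_cover p (gT : finGroupType) (G : {group gT}) n
    (a : {group gT}) (s : seq {group gT}) (B : {group gT}) :
  prime p -> p.-group G -> ((size s).+2 <= p)%N ->
  {in a :: s, forall H : {group gT}, ~~ (G \subset H)} ->
  (p ^ 2 <= #|G : B|)%N ->
  (forall x, x \in G -> {in a :: s, forall H : {group gT}, x \notin H} ->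
     x \notin B -> (breadth p G x < n)%N) ->
  (#|G^`(1)| <= p ^ 'C(n, 2))%N.
Proof.
move=> pr_p pG les; have p_gt1 := prime_gt1 pr_p.
have p_gt0 := prime_gt0 pr_p.
have [m] := ubnP #|G|; elim: m => // m IHm in G n a B pG *.
rewrite ltnS => leGm ntGs iB low.
(* Here the trivial group serves as [B], which needs [p ^ 2 <= #|M|]; a smaller [M] is abelian. *)
have IH1 (M : {group gT}) c k : M \proper G ->
    {in c :: s, forall H : {group gT}, ~~ (M \subset H)} ->
    (forall x, x \in M -> {in c :: s, forall H : {group gT}, x \notin H} ->
      (breadth p M x < k)%N) -> (#|M^`(1)| <= p ^ 'C(k, 2))%N.
  move=> prM ntMs lowM; have pM := pgroupS (proper_sub prM) pG.
  have [leM | ltM] := leqP (p ^ 2) #|M|.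
    apply: (IHm M k c 1%G) => //; last by move=> x Mx nx _; apply: lowM.
      exact: leq_trans (proper_card prM) leGm.
    by rewrite indexg1.
  have /derG1P/eqP : abelian M.
    apply: (p2group_abelian pM); rewrite -(leq_exp2l _ _ p_gt1).
    by rewrite -p_part part_pnat_id // ltnW.
  by move=> /eqP->; rewrite cards1 expn_gt0 p_gt0.
have [ab | nab] := boolP (abelian G).
  by rewrite (derG1P ab) cards1 expn_gt0 p_gt0.
have [A maxA sGaA] := maximal_setI_exists (ntGs a (mem_head _ _)).
have notAs x : x \in G -> {in A :: s, forall H : {group gT}, x \notin H} ->
    {in a :: s, forall H : {group gT}, x \notin H}.
  move=> Gx nx H; rewrite in_cons => /predU1P[-> | sH]; last first.
    by rewrite nx // in_cons sH orbT.
  apply: contra (nx A (mem_head _ _)) => ax.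
  by rewrite (subsetP sGaA) // inE Gx.
have ntGAs : {in A :: s, forall H : {group gT}, ~~ (G \subset H)}.
  move=> H; rewrite in_cons => /predU1P[-> | sH]; first exact: maximal_not_sub.
  by rewrite ntGs // in_cons sH orbT.
have {ntGs}ntGs' : {in s, forall H : {group gT}, ~~ (G \subset H)}.
  by move=> H sH; rewrite ntGs // in_cons sH orbT.
have ntGB : ~~ (G \subset B).
  rewrite -indexg_eq1; apply: contraTneq iB => ->.
  by rewrite -ltnNge (ltn_exp2l 0).
have [K maxK sGBK] := maximal_setI_exists ntGB.
(* Containing [w] will keep [M] from lying inside [A] or a member of [s]. *)
have [||w Gw nw] := @p_group_not_covered p _ G [:: K, A & s] pr_p pG.
- by [].
- by move=> H /predU1P[-> | /ntGAs//]; apply: maximal_not_sub.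
have {nw}[K'w nw] : w \notin K /\ {in A :: s, forall H : {group gT}, w \notin H}.
  by split=> [|H sH]; apply: nw; rewrite in_cons ?eqxx ?sH ?orbT.
have [M maxM /andP[Mw sMKA]] :
    exists2 M : {group gT}, maximal M G & (w \in M) && (M :&: K \subset A).
  (* If [K \subset A], any maximal subgroup containing [w] works; one exists because [G] is not
     cyclic. *)
  have [sKA | ntKA] := boolP (K \subset A); last first.
    exact: (p_maximal_pencil pr_p pG).
  have [|eqG | [M maxM]] := @maximal_exists _ <[w]>%G G; rewrite ?cycle_subG //.
    by case/negP: nab; rewrite -eqG cycle_abelian.
  by move=> Mw; exists M; rewrite // Mw (subset_trans (subsetIr _ _)).
have ntMs : {in A :: s, forall H : {group gT}, ~~ (M \subset H)}.
  by move=> H sH; apply: contra (nw H sH) => /subsetP->.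
have prM := maxgroupp maxM; have sMG := proper_sub prM.
have pM := pgroupS sMG pG.
have ltMm : (#|M| < m)%N := leq_trans (proper_card prM) leGm.
have lowM x : x \in M -> {in A :: s, forall H : {group gT}, x \notin H} ->
    (breadth p G x < n)%N.
  move=> Mx nx; have Gx := subsetP sMG x Mx.
  apply: low (notAs x Gx nx) _ => //.
  apply: contra (nx A (mem_head _ _)) => Bx.
  by rewrite (subsetP sMKA) // inE Mx (subsetP sGBK) // inE Gx.
have [k [Z [sZM iZ -> lek lowMZ]]] := maximal_breadth_step pr_p pG maxM.
have ltkn : (k < n)%N.
  have [z [Gz M'z B'z nz]] :=
    p_group_avoid pr_p pG maxA maxM (ntMs A (mem_head _ _)) iB les ntGs'.
  exact: leq_ltn_trans (lek z Gz M'z) (low z Gz (notAs z Gz nz) B'z).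
case: n => // n in low lowM ltkn *; rewrite ltnS in ltkn.
have {}lowMZ x : x \in M -> {in A :: s, forall H : {group gT}, x \notin H} ->
    x \notin Z -> (breadth p M x < n)%N.
  by move=> Mx nx Z'x; apply: leq_trans (lowMZ x Mx Z'x) (lowM x Mx nx).
have binSn q : 'C(q.+1, 2) = (q + 'C(q, 2))%N by rewrite binS bin1 addnC.
have finish : (#|M^`(1)| <= p ^ 'C(n, 2))%N ->
    (p ^ k * #|M^`(1)| <= p ^ 'C(n.+1, 2))%N.
  by move=> leM; rewrite binSn expnD leq_mul // leq_pexp2l.
case: k => [|[|k]] in iZ lek ltkn finish *.
- rewrite mul1n; apply: IH1 ntMs _ => // x Mx nx.
  by apply: leq_ltn_trans (lowM x Mx nx); apply: leq_breadth.
(* [Z] has index only [p] in [M], too small to serve as [B]. *)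
- rewrite expn1 in iZ.
  have maxZ : maximal Z M by apply: p_index_maximal; rewrite ?iZ.
  have [A1 maxA1 sMAA1] := maximal_setI_exists (ntMs A (mem_head _ _)).
  have notA1s x : x \in M ->
      {in A1 :: s, forall H : {group gT}, x \notin H} ->
      {in A :: s, forall H : {group gT}, x \notin H}.
    move=> Mx nx H; rewrite in_cons => /predU1P[-> | sH].
      apply: contra (nx A1 (mem_head _ _)) => Ax.
      by rewrite (subsetP sMAA1) // inE Mx.
    by rewrite nx // in_cons sH orbT.
  have ntMA1s : {in A1 :: s, forall H : {group gT}, ~~ (M \subset H)}.
    move=> H; rewrite in_cons => /predU1P[-> | sH].
      exact: maximal_not_sub.
    by rewrite ntMs // in_cons sH orbT.
  (* If [Z] lies in one of the other subgroups, avoiding it costs nothing. *)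
  have [/hasP[H sH sZH] | /hasPn ntZs] :=
      boolP (has (fun H : {group gT} => Z \subset H) (A1 :: s)).
    apply/finish/(IH1 M A1) => // x Mx nx; apply: lowMZ (notA1s x Mx nx) _ => //.
    by apply: contra (nx H sH) => /(subsetP sZH).
  have [||v Mv nv] := @p_group_not_covered p _ M [:: Z, A1 & s] pr_p pM.
  - by [].
  - move=> H; rewrite in_cons => /predU1P[-> | /ntMA1s//].
    exact: maximal_not_sub.
  have {nv}[Z'v nv] :
      v \notin Z /\ {in A1 :: s, forall H : {group gT}, v \notin H}.
    by split=> [|H sH]; apply: nv; rewrite in_cons ?eqxx ?sH ?orbT.
  have [P maxP /andP[Pv sPZA1]] :=
    p_maximal_pencil pr_p pM maxZ maxA1 (ntZs A1 (mem_head _ _)) Mv Z'v.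
  have ntPs : {in A1 :: s, forall H : {group gT}, ~~ (P \subset H)}.
    by move=> H sH; apply: contra (nv H sH) => /subsetP->.
  have prPM := maxgroupp maxP; have sPM := proper_sub prPM.
  have prP : P \proper G := proper_trans prPM prM.
  have pP := pgroupS sPM pM.
  have lowP x : x \in P -> {in A1 :: s, forall H : {group gT}, x \notin H} ->
      (breadth p M x < n)%N.
    move=> Px nx; have Mx := subsetP sPM x Px.
    apply: lowMZ (notA1s x Mx nx) _ => //.
    apply: contra (nx A1 (mem_head _ _)) => Zx.
    by rewrite (subsetP sPZA1) // inE Px.
  have [j [Y [sYP iY -> lej lowPY]]] := maximal_breadth_step pr_p pM maxP.
  (* On [Z] only the breadth in [G] is controlled, by [n.+1]; hence [j <= n] rather than [j < n]. *)
  have lejn : (j <= n)%N.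
    have [||y Zy ny] :=
        @p_group_not_covered p _ Z [:: P, A1 & s] pr_p (pgroupS sZM pM).
    - by [].
    - move=> H; rewrite in_cons => /predU1P[-> | /ntZs//].
      apply: contra Z'v => sZP.
      by rewrite (maximal_sub_eq maxP maxZ sZP).
    have My := subsetP sZM y Zy.
    rewrite -ltnS; apply: leq_ltn_trans (lowM y My _).
      apply: leq_trans (lej y My _) (leq_breadth y pr_p pG sMG).
      by rewrite ny ?mem_head.
    by apply: notA1s => // H sH; rewrite ny // in_cons sH orbT.
  (* For [j < n], the factor [p ^ j.+1] is at most [p ^ n], so the bound for [P] with [n]
     suffices. *)
  have [ltjn | lenj] := ltnP j n.
    have leP : (#|P^`(1)| <= p ^ 'C(n, 2))%N.
      apply: (IH1 P A1) => // x Px nx.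
      exact: leq_ltn_trans (leq_breadth x pr_p pM sPM) (lowP x Px nx).
    by rewrite binSn expnD mulnA -expnD leq_mul // leq_pexp2l.
  have {lejn lenj}def_j : j = n by apply/eqP; rewrite eqn_leq lejn.
  (* [n = 0] contradicts [k <= n] with [k = 1]. For [n = 1], an element of [P] outside [Y] and the
     other subgroups would have breadth in [P] below a breadth that is zero. *)
  case: n => [//|[|n]] in low lowM lowMZ lowP finish ltkn def_j *.
    have [||y Py ny] := @p_group_not_covered p _ P [:: Y, A1 & s] pr_p pP.
    - by [].
    - move=> H; rewrite in_cons => /predU1P[-> | /ntPs//].
      by rewrite -indexg_eq1 iY def_j expn1 neq_ltn p_gt1 orbT.
    have Y'y : y \notin Y by rewrite ny ?mem_head.
    have{}ny : {in A1 :: s, forall H : {group gT}, y \notin H}.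
      by move=> H sH; rewrite ny // in_cons sH orbT.
    by have := leq_ltn_trans (lowPY y Py Y'y) (lowP y Py ny).
  (* Now [j = n.+2], so [Y] is small enough to serve as [B], and the breadth bound on [P] drops once
     more. *)
  have leP : (#|P^`(1)| <= p ^ 'C(n.+1, 2))%N.
    apply: (IHm P n.+1 A1 Y) => //; first exact: leq_trans (proper_card prP) leGm.
      by rewrite iY def_j leq_pexp2l.
    by move=> x Px nx Y'x; apply: leq_trans (lowPY x Px Y'x) (lowP x Px nx).
  rewrite mulnA -expnD def_j (leq_trans (leq_mul (leqnn _) leP)) // -expnD.
  by rewrite leq_pexp2l // !binSn !addnA leq_add2r add1n addnS ltnS leq_addr.
(* For [k] at least 2 in the original numbering, [Z] itself serves as [B] in [M]. *)
apply/finish/(IHm M n A Z) => //.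
by rewrite iZ leq_pexp2l.
Qed.

Theorem theorem2p3 (p : nat) (gT : finGroupType) (G : {group gT}) (n : nat) :
  prime p -> p.-group G ->
  (p ^ (n * (n - 1) %/ 2) < #|G^`(1)|)%N ->
  ~ (exists H : 'I_p -> {group gT},
       [/\ forall i, H i \proper G,
           exists i, (p ^ 2 <= #|G : H i|)%N
         & forall x, x \in G -> (n <= breadth p G x)%N -> exists i, x \in H i]).
Proof.
move=> pr_p pG + [H [prH [i iHi] covH]].
rewrite subn1 divn2 -bin2 ltnNge => /negP[].
(* [H i] becomes [B]; the other [p - 1] subgroups form a list, nonempty since [p > 1], whose head is
   [a]. *)
pose t := [seq H j | j <- rem i (enum 'I_p)].
have sz_t : size t = p.-1 by rewrite size_map size_rem ?mem_enum // size_enum_ord.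
have ntGt : {in t, forall K : {group gT}, ~~ (G \subset K)}.
  by move=> _ /mapP[j _ ->]; apply: proper_subn.
have low x : x \in G -> {in t, forall K : {group gT}, x \notin K} ->
    x \notin H i -> (breadth p G x < n)%N.
  move=> Gx nx nHi; rewrite ltnNge; apply/negP=> /(covH x Gx)[j Hjx].
  have [eq_ji | ne_ji] := eqVneq j i; first by rewrite -eq_ji Hjx in nHi.
  suff /nx/negP[] : H j \in t by [].
  by rewrite map_f // (mem_rem_uniq _ (enum_uniq _)) inE ne_ji mem_enum.
case def_t: t sz_t ntGt low => [|a s] /= sz_t ntGt low.
  by have := prime_gt1 pr_p; rewrite -[p]prednK ?prime_gt0 // -sz_t.
apply: (card_der1_breadth_cover pr_p pG _ ntGt iHi low).
by rewrite sz_t prednK ?prime_gt0.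
Qed.
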